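(* Let $p_0\in(0,1)$, $a_\alpha,b_\alpha,a_\beta,b_\beta>0$, and consider the two-sided all-accept verification cascade (as described in the context) with $G=\mathrm{Beta}(a_\alpha,b_\alpha)$ and $H=\mathrm{Beta}(a_\beta,b_\beta)$. For integers $j\ge0$ the net evidence $\delta_{j+1}:=\ell_{j+1}-\ell_j$ of gate $j+1$ is $$\delta_{j+1}=\ln\frac{\mathbb{E}^{H}_{(j)}[\beta]}{\mathbb{E}^{G}_{(j)}[\alpha]}=\ln\frac{(a_\beta+j)/(a_\beta+b_\beta+j)}{(a_\alpha+j)/(a_\alpha+b_\alpha+j)},$$ i.e. gate $j+1$ helps ($\delta_{j+1}>0$) if and only if $\mathbb{E}^{H}_{(j)}[\beta]>\mathbb{E}^{G}_{(j)}[\alpha]$ (among survivors of the first $j$ gates, correct answers are accepted more often than erroneous ones). The sign of $\delta_{j+1}$ changes at most once in $j$, and (when $b_\alpha\neq b_\beta$) the change can occur only at $$j=k^\dagger:=\frac{a_\alpha b_\beta-a_\beta b_\alpha}{b_\alpha-b_\beta}.$$ Consequently, if $b_\alpha<b_\beta$ and $\delta_1>0$, then $r_k$ is unimodal in the integer $k\ge0$ (first increasing, then decreasing) and is maximized at $k_{\mathrm{opt}}=\lceil k^\dagger\rceil$.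
   Context: Two-sided all-accept cascade: a candidate answer has a random truth label $C\in\{0,1\}$ with $\mathbb{P}(C=1)=p_0$, and is passed through $k$ gates, each returning accept or reject. Given $C=0$, a latent false-accept rate $\alpha$ is drawn from $G$, and conditionally on $\alpha$ the $k$ verdicts are i.i.d., each accept with probability $\alpha$. Given $C=1$, a latent true-accept rate $\beta$ is drawn from $H$, and conditionally on $\beta$ the $k$ verdicts are i.i.d., each accept with probability $\beta$. Define $r_k=\mathbb{P}(C=1\mid\text{all }k\text{ gates accept})$ and $\ell_k=\ln\frac{r_k}{1-r_k}$, so $\ell_0=\ln\frac{p_0}{1-p_0}$. Equivalently $\ell_k=\ell_0+\ln m_k^{(\beta)}-\ln m_k^{(\alpha)}$ with $m_k^{(\alpha)}=\mathbb{E}_{\alpha\sim G}[\alpha^k]$, $m_k^{(\beta)}=\mathbb{E}_{\beta\sim H}[\beta^k]$. $\mathbb{E}^{G}_{(j)}$ (resp. $\mathbb{E}^{H}_{(j)}$) denotes expectation under the tilted probability distribution proportional to $x^j\,dG(x)$ (resp. $x^j\,dH(x)$). For the location of the sign change, the displayed formula for $\delta_{j+1}$ is regarded as a function of real $j\ge0$. Unimodality and the optimum allow the possible tie $\delta_{k^\dagger+1}=0$ when $k^\dagger$ is an integer. *)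

(* Defs.v *)
From HB Require Import structures.
From mathcomp Require Import all_boot all_order all_algebra.
From mathcomp Require Import all_classical all_reals all_analysis measurable_realfun.

Set Implicit Arguments.
Unset Strict Implicit.
Unset Printing Implicit Defensive.

Import Order.TTheory GRing.Theory Num.Theory.
Import numFieldNormedType.Exports.

Local Open Scope classical_set_scope.
Local Open Scope ring_scope.

Lemma density_semi_sigma_additive (d : measure_display) (T : measurableType d)
    (R : realType) (mu : {measure set T -> \bar R}) (f : T -> \bar R) :
  (forall x, 0 <= f x)%E -> measurable_fun setT f ->
  semi_sigma_additive (fun A => \int[mu]_(x in A) f x)%E.
Proof.
move=> f0 mf F mF tF mUF; apply: cvg_toP.
  apply: ereal_nondecreasing_is_cvgn => m n mn.
  by apply: lee_sum_nneg_natr => // k _ _; exact: integral_ge0.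
by rewrite ge0_integral_bigcup//=; exact: measurable_funTS.
Qed.

Section beta_dist.
Context {R : realType}.
Variables a b : R.

(* The library's [beta_prob] only has natural-number parameters. *)
Definition beta_density (x : R) : R :=
  if x \in `]0, 1[ then x `^ (a - 1) * (1 - x) `^ (b - 1) else 0.

Definition beta_weight (A : set R) : \bar R :=
  (\int[lebesgue_measure]_(x in A) (beta_density x)%:E)%E.

Lemma beta_density_ge0 x : 0 <= beta_density x.
Proof. by rewrite /beta_density; case: ifP => // _; rewrite mulr_ge0// powR_ge0. Qed.

Lemma measurable_beta_density : measurable_fun [set: R] beta_density.
Proof.
apply: measurable_fun_ifT.
- rewrite (_ : (fun x : R => x \in `]0, 1[) = (fun x : R => (0 < x) && (x < 1)));
    last by apply/funext => x; rewrite in_itv.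
  by apply: measurable_and; exact: measurable_fun_ltr.
- apply: measurable_funM; first exact: measurable_powR.
  by apply: measurableT_comp (measurable_powR _) _; exact: measurable_funB.
- exact: measurable_cst.
Qed.

Let beta_weight0 : beta_weight set0 = 0%E.
Proof. by rewrite /beta_weight integral_set0. Qed.

Let beta_weight_ge0 A : (0 <= beta_weight A)%E.
Proof. by apply: integral_ge0 => x _; rewrite lee_fin beta_density_ge0. Qed.

Let beta_weight_sigma_additive : semi_sigma_additive beta_weight.
Proof.
apply: (@density_semi_sigma_additive _ _ R lebesgue_measure
  (fun x => (beta_density x)%:E)).
- by move=> x; rewrite lee_fin beta_density_ge0.
- by apply/measurable_EFinP; exact: measurable_beta_density.
Qed.

HB.instance Definition _ := isMeasure.Build _ _ _ beta_weight
  beta_weight0 beta_weight_ge0 beta_weight_sigma_additive.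

(* [mnormalize mu Q] falls back to [Q] only when [mu] has mass 0 or +oo, which
   does not happen here for a, b > 0. *)
Definition beta_dist : probability R R := mnormalize beta_weight \d_(0 : R).

End beta_dist.

Section tilting.
Context {R : realType}.
Variables (G : probability R R) (j : nat).

(* Restricted to [0, 1], where rates live, so that x ^+ j >= 0. *)
Definition tilt_density (x : R) : R := if x \in `[0, 1] then x ^+ j else 0.

Definition tilt_weight (A : set R) : \bar R :=
  (\int[G]_(x in A) (tilt_density x)%:E)%E.

Lemma tilt_density_ge0 x : 0 <= tilt_density x.
Proof.
rewrite /tilt_density; case: ifP => //.
by rewrite in_itv/= => /andP[x0 _]; exact: exprn_ge0.
Qed.

Lemma measurable_tilt_density : measurable_fun [set: R] tilt_density.
Proof.
apply: measurable_fun_ifT.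
- rewrite (_ : (fun x : R => x \in `[0, 1]) = (fun x : R => (0 <= x) && (x <= 1)));
    last by apply/funext => x; rewrite in_itv.
  by apply: measurable_and; exact: measurable_fun_ler.
- exact: measurable_funX.
- exact: measurable_cst.
Qed.

Let tilt_weight0 : tilt_weight set0 = 0%E.
Proof. by rewrite /tilt_weight integral_set0. Qed.

Let tilt_weight_ge0 A : (0 <= tilt_weight A)%E.
Proof. by apply: integral_ge0 => x _; rewrite lee_fin tilt_density_ge0. Qed.

Let tilt_weight_sigma_additive : semi_sigma_additive tilt_weight.
Proof.
apply: (@density_semi_sigma_additive _ _ R G (fun x => (tilt_density x)%:E)).
- by move=> x; rewrite lee_fin tilt_density_ge0.
- by apply/measurable_EFinP; exact: measurable_tilt_density.
Qed.

HB.instance Definition _ := isMeasure.Build _ _ _ tilt_weight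
  tilt_weight0 tilt_weight_ge0 tilt_weight_sigma_additive.

(* The fallback [G] is used only if x ^ j dG(x) has mass 0 on [0, 1]. *)
Definition tilted : probability R R := mnormalize tilt_weight G.

Definition tilted_mean : R := fine 'E_tilted[idfun]%E.

End tilting.

Section cascade.
Context {R : realType} {d : measure_display} {Omega : measurableType d}.
Variable P : probability Omega R.
Variable C : {RV P >-> bool}.
Variables alpha beta : {RV P >-> R}.
(* [V i] is the verdict of the (i+1)-st gate. *)
Variable V : nat -> {RV P >-> bool}.

Definition label (c : bool) : set Omega := C @^-1` [set c].

Definition verdicts (k : nat) (v : 'I_k -> bool) : set Omega :=
  [set w | forall i : 'I_k, V i w = v i].

(* Given [C = c], [X] is distributed as [G] and, conditionally on [X], the
   verdicts are i.i.d. Bernoulli [X]: the second clause says that the product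
   Bernoulli mass is a version of the conditional probability, given [X], of the
   verdicts of the first [k] gates on [C = c]. *)
Definition latent_rate (c : bool) (X : {RV P >-> R}) (G : probability R R) :=
  (forall A : set R, measurable A ->
     P (label c `&` X @^-1` A) = P (label c) * G A)%E /\
  (forall (k : nat) (v : 'I_k -> bool) (A : set R), measurable A ->
     P (label c `&` X @^-1` A `&` verdicts v) =
     \int[P]_(w in label c `&` X @^-1` A)
       (\prod_(i < k) bernoulli_pmf (X w) (v i))%:E)%E.

Record two_sided_cascade (p0 : R) (G H : probability R R) : Prop :=
  TwoSidedCascade {
    cascade_prior : P (label true) = p0%:E;
    cascade_false_accept : latent_rate false alpha G;
    cascade_true_accept : latent_rate true beta H }.

Definition all_accept (k : nat) : set Omega := verdicts (fun _ : 'I_k => true).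

(* r_k = P(C = 1 | all k gates accept) *)
Definition posterior (k : nat) : R :=
  fine (P (label true `&` all_accept k)) / fine (P (all_accept k)).

Definition log_odds (k : nat) : R := ln (posterior k / (1 - posterior k)).

(* delta_n, meaningful for n >= 1 *)
Definition net_evidence (n : nat) : R := log_odds n - log_odds n.-1.

End cascade.

Section sign_changes.
Context {R : realType}.

(* No three successive points of [D] carry alternating strict signs. *)
Definition sign_changes_at_most_once (disp : Order.disp_t)
    (T : porderType disp) (D : set T) (f : T -> R) : Prop :=
  forall x y z, D x -> D y -> D z -> (x < y)%O -> (y < z)%O ->
    ~ (f x * f y < 0 /\ f y * f z < 0).

(* Both strict signs occur, on the two sides of [t], arbitrarily close to [t]. *)
Definition sign_change_at (D : set R) (f : R -> R) (t : R) : Prop :=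
  forall e : R, 0 < e -> exists x y : R,
    [/\ D x, D y, t - e < x <= t, t <= y < t + e & f x * f y < 0].

End sign_changes.

Section beta_cascade.
Context {R : realType}.
Variables a_alpha b_alpha a_beta b_beta : R.

Definition evidence_formula (j : R) : R :=
  ln (((a_beta + j) / (a_beta + b_beta + j)) /
      ((a_alpha + j) / (a_alpha + b_alpha + j))).

Definition k_dagger : R :=
  (a_alpha * b_beta - a_beta * b_alpha) / (b_alpha - b_beta).

End beta_cascade.

(* Main.v *)
(** Tilting a beta law by x^j raises its first parameter by j, and integrating the
derivative of x^a (1 - x)^b over (0, 1) gives B(a + 1, b) = a / (a + b) B(a, b);
so the mean of the tilted law is (a + j) / (a + b + j).  The posterior odds after
k accepts are p0 E_H[beta^k] / ((1 - p0) E_G[alpha^k]), hence each gate multiplies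
them by the ratio of the two tilted means.  That ratio exceeds 1 exactly when
(a_beta + j) b_alpha - (a_alpha + j) b_beta > 0, an affine condition in j vanishing
only at k_dagger when b_alpha <> b_beta. *)

Require Import Defs.
From mathcomp Require Import all_boot all_order all_algebra.
From mathcomp Require Import all_classical all_reals all_analysis measurable_realfun.
From mathcomp Require Import ring lra.

Import Order.TTheory GRing.Theory Num.Theory.
Import numFieldNormedType.Exports.

Local Open Scope classical_set_scope.
Local Open Scope ring_scope.

(** * Integration against a measure with a density *)

Section density.
Local Open Scope ereal_scope.
Import HBNNSimple.

(** Approximate [g] from below by simple functions and pass to the limit on both sides by monotone
    convergence. In every use [phi] is the identity, possibly between two measurable types with the
    same carrier, such as [measurableTypeR R] and [R]. *)
Lemma ge0_integral_density (d d' : measure_display) (T : measurableType d)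
    (T' : measurableType d') (R : realType) (mu : {measure set T -> \bar R})
    (nu : {measure set T' -> \bar R}) (phi : T -> T') (h : T -> R)
    (g : T' -> \bar R) :
  measurable_fun setT phi ->
  (forall x, (0 <= h x)%R) -> measurable_fun setT h ->
  (forall A, measurable A -> nu A = \int[mu]_(x in phi @^-1` A) (h x)%:E) ->
  (forall x, 0 <= g x) -> measurable_fun setT g ->
  \int[nu]_x g x = \int[mu]_x (g (phi x) * (h x)%:E).
Proof.
move=> mphi h0 mh nuE g0 mg.
have mhE : measurable_fun setT (EFin \o h) by exact/measurable_EFinP.
pose g_ := nnsfun_approx measurableT mg.
have mg_ n : measurable_fun setT (fun x => (g_ n x)%:E).
  by apply/measurable_EFinP; exact: measurable_funPT.
have mg_phi n : measurable_fun setT (fun x => (g_ n (phi x))%:E).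
  exact: (measurableT_comp (mg_ n)).
have nd_g x : {homo (fun n => (g_ n x)%:E) : m n / (m <= n)%N >-> m <= n}.
  by move=> m n mn; rewrite lee_fin; exact/lefP/nd_nnsfun_approx.
have cg x : (fun n => (g_ n x)%:E) @ \oo --> g x.
  by apply: cvg_nnsfun_approx.
transitivity (limn (fun n => \int[nu]_x (g_ n x)%:E)).
  rewrite -monotone_convergence//.
  - by apply: eq_integral => y _; apply/esym/cvg_lim => //; exact: cg.
  - by move=> n y _; rewrite lee_fin.
transitivity (limn (fun n => \int[mu]_x ((g_ n (phi x))%:E * (h x)%:E))); last first.
  rewrite -monotone_convergence//.
  - apply: eq_integral => y _; apply/cvg_lim => //.
    by apply: cvgeZr => //; exact: cg.
  - by move=> n; exact: emeasurable_funM.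
  - by move=> n y _; rewrite mule_ge0// lee_fin.
  - by move=> y _ m n mn; rewrite lee_wpmul2r// ?lee_fin//; exact: nd_g.
(* For a simple function both integrals are finite sums over its values, and the hypothesis on [nu]
   is applied to each level set. *)
congr (limn _); apply/funext => n.
rewrite integralT_nnsfun sintegralE.
transitivity (\int[mu]_x (\sum_(k \in range (g_ n))
    (k%:E * (\1_(g_ n @^-1` [set k]) (phi x))%:E * (h x)%:E))); last first.
  apply: eq_integral => x _; rewrite [in RHS]fimfunE -fsumEFin//.
  rewrite -ge0_mule_fsuml//.
  by move=> i; exact: nnfun_muleindic_ge0.
have mind r : measurable_fun setT (fun x => (\1_(g_ n @^-1` [set r]) (phi x))%:E).
  apply/measurable_EFinP.
  apply: measurableT_comp mphi; apply: measurable_indic.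
  exact: measurable_sfunP.
rewrite ge0_integral_fsum//; first last.
  - by move=> r x _; rewrite mule_ge0 ?lee_fin//; exact: nnfun_muleindic_ge0.
  - by move=> r; apply: emeasurable_funM => //; exact: emeasurable_funM.
apply: eq_fsbigr => r; rewrite inE => -[x _ gx].
have r0 : (0 <= r)%R by rewrite -gx.
under eq_integral do rewrite -muleA.
rewrite ge0_integralZl_EFin//; last 2 first.
  - by move=> y _; rewrite mule_ge0// lee_fin.
  - exact: emeasurable_funM.
rewrite nuE// integral_mkcond epatch_indic.
by congr (_ * _); apply: eq_integral => y _; rewrite /= muleC.
Qed.

(** A mass strictly between 0 and +oo excludes the fallback [Q], so normalizing is scaling by the
    inverse mass. *)
Lemma mnormalize_density (d d' : measure_display) (T : measurableType d)
    (T' : measurableType d') (R : realType) (mu : {measure set T -> \bar R})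
    (nu : {measure set T' -> \bar R}) (Q : probability T' R)
    (phi : T -> T') (h : T -> R) (g : T' -> \bar R) :
  measurable_fun setT phi ->
  (forall x, (0 <= h x)%R) -> measurable_fun setT h ->
  (forall A, measurable A -> nu A = \int[mu]_(x in phi @^-1` A) (h x)%:E) ->
  0 < nu setT < +oo ->
  (forall x, 0 <= g x) -> measurable_fun setT g ->
  \int[mnormalize nu Q]_x g x =
  \int[mu]_x (g (phi x) * (h x)%:E) * ((fine (nu setT))^-1)%:E.
Proof.
move=> mphi h0 mh nuE /andP[nu0 nuy] g0 mg.
have c0 : (0 <= (fine (nu setT))^-1)%R by rewrite invr_ge0 fine_ge0.
rewrite [LHS](eq_measure_integral (mscale (NngNum c0) nu)); last first.
  move=> A mA _; rewrite /= /mnormalize; case: ifPn => [|_].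
    by move=> /orP[]/eqP E; exfalso; move: nu0 nuy; rewrite E ltxx.
  by rewrite /mscale/= muleC.
rewrite ge0_integral_mscale//= muleC; congr (_ * _).
exact: ge0_integral_density.
Qed.

End density.

(** * Sign of the evidence formula in a real variable *)

Lemma ln_div_gt0 {R : realType} (x y : R) : 0 < x -> 0 < y ->
  (0 < ln (x / y)) = (y < x).
Proof.
move=> x0 y0; rewrite -[X in X < _]ln1 ltr_ln ?posrE ?divr_gt0//.
by rewrite ltr_pdivlMr// mul1r.
Qed.

Lemma ln_div_lt0 {R : realType} (x y : R) : 0 < x -> 0 < y ->
  (ln (x / y) < 0) = (x < y).
Proof.
move=> x0 y0; rewrite -[X in _ < X]ln1 ltr_ln ?posrE ?divr_gt0//.
by rewrite ltr_pdivrMr// mul1r.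
Qed.

Section evidence_sign.
Context {R : realType}.
Variables aa ba ab bb : R.
Hypotheses (aa0 : 0 < aa) (ba0 : 0 < ba) (ab0 : 0 < ab) (bb0 : 0 < bb).
Local Notation f := (evidence_formula aa ba ab bb).
Local Notation kdag := (k_dagger aa ba ab bb).

(** What is left of [(ab + j) (aa + ba + j) - (aa + j) (ab + bb + j)] once the common product
    [(aa + j) (ab + j)] cancels. *)
Definition evidence_numerator (j : R) := (ab + j) * ba - (aa + j) * bb.

Lemma evidence_formula_gt0 (j : R) : 0 <= j ->
  (0 < f j) = (0 < evidence_numerator j).
Proof.
move=> j0; rewrite /evidence_formula /evidence_numerator.
have A : 0 < aa + ba + j by rewrite ltr_wpDr// addr_gt0.
have B : 0 < ab + bb + j by rewrite ltr_wpDr// addr_gt0.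
have C : 0 < aa + j by rewrite ltr_wpDr.
have D : 0 < ab + j by rewrite ltr_wpDr.
rewrite ln_div_gt0 ?divr_gt0// ltr_pdivrMr// mulrAC ltr_pdivlMr//.
by rewrite -subr_gt0; congr (_ < _); ring.
Qed.

Lemma evidence_formula_lt0 (j : R) : 0 <= j ->
  (f j < 0) = (evidence_numerator j < 0).
Proof.
move=> j0; rewrite /evidence_formula /evidence_numerator.
have A : 0 < aa + ba + j by rewrite ltr_wpDr// addr_gt0.
have B : 0 < ab + bb + j by rewrite ltr_wpDr// addr_gt0.
have C : 0 < aa + j by rewrite ltr_wpDr.
have D : 0 < ab + j by rewrite ltr_wpDr.
rewrite ln_div_lt0 ?divr_gt0// ltr_pdivlMr// mulrAC ltr_pdivrMr//.
by rewrite -subr_lt0; congr (_ < _); ring.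
Qed.

Lemma evidence_numeratorE (j : R) : ba != bb ->
  evidence_numerator j = (ba - bb) * (j - kdag).
Proof.
by move=> bab; rewrite /evidence_numerator /k_dagger; field; rewrite subr_eq0.
Qed.

Lemma evidence_formula_sgr (j : R) : 0 <= j ->
  Num.sg (f j) = Num.sg (evidence_numerator j).
Proof.
move=> j0; have Egt := evidence_formula_gt0 j j0.
have Elt := evidence_formula_lt0 j j0.
case: (sgrP (evidence_numerator j)) => h; apply/eqP; rewrite ?sgr_cp0.
- by rewrite eq_le !leNgt Egt Elt h ltxx.
- by rewrite Egt.
- by rewrite Elt.
Qed.

Lemma evidence_formulaM_lt0 (x y : R) : 0 <= x -> 0 <= y ->
  (f x * f y < 0) = (evidence_numerator x * evidence_numerator y < 0).
Proof.
by move=> x0 y0; rewrite -[LHS]sgr_cp0 -[RHS]sgr_cp0 !sgrM !evidence_formula_sgr.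
Qed.

(** The product of the two numerators is [(ba - bb)^2 (x - kdag) (y - kdag)], so its sign is that of
    the last two factors. *)
Lemma evidence_formulaM_lt0_between (x y : R) : ba != bb -> 0 <= x -> x < y ->
  f x * f y < 0 -> x < kdag < y.
Proof.
move=> bab x0 xy; rewrite evidence_formulaM_lt0//; last lra.
rewrite !evidence_numeratorE// mulrACA -expr2 pmulr_rlt0; last first.
  by rewrite exprn_even_gt0 //= subr_eq0.
move: kdag => k h; apply/andP; split; nra.
Qed.

(** Two successive changes would put [kdag] both below and above [y]. If [ba = bb], the numerator is
    constant and the product of two of its values is a square. *)
Lemma evidence_formula_sign_changes :
  sign_changes_at_most_once [set x : R | 0 <= x] f.
Proof.
move=> x y z /= x0 y0 z0 xy yz.
have [bab|bab [H1 H2]] := eqVneq ba bb.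
  rewrite !evidence_formulaM_lt0//.
  have E w : evidence_numerator w = (ab - aa) * bb.
    by rewrite /evidence_numerator bab; ring.
  by rewrite !E -expr2 ltNge sqr_ge0 => -[].
have /andP[_ ] := evidence_formulaM_lt0_between _ _ bab x0 xy H1.
have /andP[ ] := evidence_formulaM_lt0_between _ _ bab y0 yz H2.
lra.
Qed.

Lemma evidence_formula_sign_change_at (t : R) : ba != bb ->
  sign_change_at [set x : R | 0 <= x] f t -> t = kdag.
Proof.
(* The radius is the distance from [t] to [kdag]: the two points of opposite sign are then closer to
   [t] than [kdag] is, yet [kdag] must lie between them. *)
move=> bab ct; apply/eqP/contraT; rewrite -subr_eq0 -normr_gt0 => e0.
have [x [y [/= x0 y0 /andP[x1 x2] /andP[y1 y2] fxy]]] := ct _ e0.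
have xy : x < y.
  rewrite lt_neqAle (le_trans x2 y1) andbT; apply: contraTN fxy => /eqP ->.
  by rewrite -leNgt -expr2 sqr_ge0.
have := evidence_formulaM_lt0_between _ _ bab x0 xy fxy.
by case: (ltrP 0 (t - kdag)) x1 y2 => h; [rewrite gtr0_norm//|rewrite ler0_norm//];
  move: kdag h => k; lra.
Qed.
End evidence_sign.

(** * The beta integral: positivity, finiteness and recursion *)

Section beta_mass.
Context {R : realType}.
Implicit Types a b x : R.

(** Multiply the density by [1 = x + (1 - x)]. *)
Lemma beta_densityS a b x :
  beta_density a b x = beta_density (a + 1) b x + beta_density a (b + 1) x.
Proof.
rewrite /beta_density; case: ifPn => [|_]; last by rewrite addr0.
rewrite in_itv/= => /andP[x0 x1].
have E r y : 0 < y -> y `^ (r + 1 - 1) = y `^ (r - 1) * y :> R.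
  move=> y0; rewrite addrAC [LHS]powRD ?(gt_eqF y0) ?implybT//.
  by rewrite powRr1 ?ltW.
by rewrite !E ?subr_gt0//; ring.
Qed.

Lemma beta_density01 a b x : x \notin `]0, 1[ -> beta_density a b x = 0.
Proof. by rewrite /beta_density => /negbTE ->. Qed.

Lemma beta_density_gt0 a b x : x \in `]0, 1[ -> 0 < beta_density a b x.
Proof.
rewrite /beta_density => /[dup] + ->; rewrite in_itv/= => /andP[x0 x1].
by rewrite mulr_gt0// powR_gt0// subr_gt0.
Qed.

Lemma beta_weight_oo a b : beta_weight a b `]0, 1[ = beta_weight a b setT.
Proof.
rewrite /beta_weight integral_mkcond; apply: eq_integral => x _.
rewrite patchE; case: ifPn => // /negP h.
by rewrite beta_density01//; apply/negP => x01; apply: h; rewrite inE.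
Qed.

Lemma beta_weightTS a b : (beta_weight a b setT =
  beta_weight (a + 1) b setT + beta_weight a (b + 1) setT)%E.
Proof.
rewrite /beta_weight -ge0_integralD//; first last.
- by apply/measurable_EFinP; exact: measurable_beta_density.
- by move=> x _; rewrite lee_fin beta_density_ge0.
- by apply/measurable_EFinP; exact: measurable_beta_density.
- by move=> x _; rewrite lee_fin beta_density_ge0.
by apply: eq_integral => x _; rewrite -EFinD -beta_densityS.
Qed.

Lemma powR_le1 a x : 0 <= a -> 0 <= x <= 1 -> x `^ a <= 1.
Proof.
move=> a0 /andP[x0 x1]; rewrite -[leRHS](congr1 (@^~ a) (powR1 R)).
by apply: ge0_ler_powR => //; rewrite ?nnegrE.
Qed.

(** The exponents are now [a] and [b], both positive, so the density is at most 1 on the unit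
    interval. *)
Lemma beta_weightSS_lty a b : 0 < a -> 0 < b ->
  (beta_weight (a + 1) (b + 1) setT < +oo)%E.
Proof.
move=> a0 b0; rewrite -beta_weight_oo.
apply: (@le_lt_trans _ _ (\int[lebesgue_measure]_(x in `]0%R, 1%R[) (cst 1 x))%E).
  apply: ge0_le_integral => //=.
  - by move=> x _; rewrite lee_fin beta_density_ge0.
  - apply/measurable_EFinP; apply: measurable_funTS.
    exact: measurable_beta_density.
  - move=> x; rewrite lee_fin /beta_density in_itv/= => /andP[x0 x1].
    rewrite x0 x1 !addrK mulr_ile1 ?powR_ge0 ?powR_le1 ?(ltW a0) ?(ltW b0)//.
      by rewrite !ltW.
    by rewrite subr_ge0 ltW//= gerBl ltW.
by rewrite integral_cst//= mul1e lebesgue_measure_itv/= lte01 oppr0 adde0 ltry.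
Qed.

(** A zero integral would make the density vanish almost everywhere on []0, 1[], where it is
    positive; but this interval has measure 1. *)
Lemma beta_weight_gt0 a b : (0 < beta_weight a b setT)%E.
Proof.
rewrite -beta_weight_oo lt0e measure_ge0 andbT; apply/eqP => W0.
have := @ae_eq_integral_abs _ _ R lebesgue_measure `]0%R, 1%R[%classic _
  (EFin \o beta_density a b).
move=> /(_ (measurable_itv _)) [].
  apply: measurable_funTS; apply/measurable_EFinP.
  exact: measurable_beta_density.
move=> + _; case.
  rewrite -W0; apply: eq_integral => x _.
  by rewrite gee0_abs// lee_fin beta_density_ge0.
move=> N [mN N0 sN].
have : (lebesgue_measure (`]0%R, 1%R[%classic : set R) <= 0)%E.
  rewrite -N0; apply: le_measure; rewrite ?inE//.
  move=> x x01; apply: sN => /= /(_ x01) [] /eqP; apply/negP.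
  by rewrite gt_eqF// beta_density_gt0.
by rewrite lebesgue_measure_itv/= lte01 oppr0 adde0 leNgt lte01.
Qed.

Lemma is_derive1_powR_onem b x : x < 1 ->
  is_derive x 1 (fun x : R => (1 - x) `^ b) (- (b * (1 - x) `^ (b - 1))).
Proof.
move=> x1; rewrite -[- (b * _)]mulrN1.
apply: (@is_derive1_comp _ (fun y => y `^ b) (fun x => 1 - x)).
  by apply: is_derive1_powR; rewrite subr_gt0.
by apply: is_derive_eq; rewrite add0r mul1r.
Qed.

Lemma cvg_powRM_at_right0 a b : 0 < a ->
  x `^ a * (1 - x) `^ b @[x --> 0^'+] --> (0 : R).
Proof.
move=> a0; rewrite -[X in _ --> X](mul0r ((1 - 0) `^ b)).
apply: cvgM; first exact: powR_cvg0.
apply: cvg_at_right_filter.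
have d1 : derivable (fun x : R => (1 - x) `^ b) 0 1.
  exact/ex_derive/is_derive1_powR_onem.
by move/derivable1_diffP/differentiable_continuous : d1; exact.
Qed.

(** Cutting at both ends keeps away from the singularities of the density at 0 and 1. Starting from
    1/3 keeps [cut n] below 1/2, so that the interval [[cut n, 1 - cut n]] is not degenerate. *)
Let cut (n : nat) : R := n.+3%:R^-1.

Let cut_gt0 n : 0 < cut n. Proof. by rewrite invr_gt0 ltr0n. Qed.

Let cut_lt_onem n : cut n < 1 - cut n.
Proof.
rewrite ltrBrDr -mulr2n -mulr_natl.
by rewrite ltr_pdivrMr ?ltr0n// mul1r ltr_nat.
Qed.

Let cvg_cut : cut n @[n --> \oo] --> (0 : R).
Proof.
(* [harmonic m] is [1 / (m + 1)], hence a shift by 2 and not by 3. *)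
rewrite (_ : cut = fun n => harmonic (n + 2)%N).
  by rewrite (cvg_shiftn 2 (harmonic : R^nat)); exact: cvg_harmonic.
by apply/funext => n; rewrite /cut /= addn2.
Qed.

Let core n : set R := `[cut n, 1 - cut n]%classic.

Let nondecreasing_core : nondecreasing_seq core.
Proof.
move=> m n mn; apply/subsetPset => x; rewrite /core /= !in_itv/= => /andP[h1 h2].
have : cut n <= cut m by rewrite lef_pV2 ?posrE ?ltr0n// ler_nat.
by move=> h3; rewrite (le_trans h3)//= (le_trans h2)// lerB.
Qed.

Let bigcup_core : \bigcup_n core n = `]0, 1[%classic.
Proof.
apply/seteqP; split => [x [n _]|x]; rewrite /core/= !in_itv/= => /andP[h1 h2].
  by rewrite (lt_le_trans (cut_gt0 n) h1)/= (le_lt_trans h2)// gtrBl.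
have m0 : 0 < Num.min x (1 - x) by rewrite lt_min h1 subr_gt0.
have [n _ Hn] := cvgr_lt 0 cvg_cut _ m0.
have := Hn n (leqnn n); rewrite /= lt_min => /andP[n1 n2].
by exists n => //=; rewrite in_itv/= ltW//=; lra.
Qed.

(** Continuity from below along the increasing cores, which exhaust the support []0, 1[] of the
    density. *)
Let cvg_core a b :
  beta_weight a b (core n) @[n --> \oo] --> beta_weight a b setT.
Proof.
rewrite -beta_weight_oo -bigcup_core.
apply: (@nondecreasing_cvg_mu _ _ _ (beta_weight a b)) => //.
- by move=> n; exact: measurable_itv.
- by apply: bigcupT_measurable => n; exact: measurable_itv.
Qed.

(** Integration by parts on the core with [F = x^a] and [G = - (1 - x)^b]; the real term on the
    right is the boundary contribution. *)
Let core_by_parts a b n : 0 < a -> 0 < b ->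
  (b%:E * beta_weight (a + 1) b (core n) =
  (cut n `^ a * (1 - cut n) `^ b - cut n `^ b * (1 - cut n) `^ a)%:E +
  a%:E * beta_weight a (b + 1) (core n))%E.
Proof.
move=> a0 b0; rewrite /beta_weight.
have in01 x : core n x -> x \in `]0, 1[.
  by move=> cx; have : (\bigcup_n core n) x by [exists n]; rewrite bigcup_core.
have mb p q : measurable_fun (core n) (EFin \o beta_density p q).
  apply: measurable_funTS; apply/measurable_EFinP.
  exact: measurable_beta_density.
have mcore : measurable (core n) by exact: measurable_itv.
have intZ k p q : 0 < k ->
    (k%:E * \int[lebesgue_measure]_(x in core n) (beta_density p q x)%:E =
     \int[lebesgue_measure]_(x in core n) (k * beta_density p q x)%:E)%E.
  move=> k0; under [RHS]eq_integral do rewrite EFinM.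
  rewrite ge0_integralZl_EFin//; [|exact: mb|by rewrite ltW].
  by move=> x _; rewrite lee_fin beta_density_ge0.
rewrite !intZ//.
pose F x : R := x `^ a. pose f x : R := a * x `^ (a - 1).
pose G x : R := - (1 - x) `^ b. pose g x : R := b * (1 - x) `^ (b - 1).
have dF x : 0 < x -> is_derive x 1 F (f x) by move=> x0; exact: is_derive1_powR.
have dG x : x < 1 -> is_derive x 1 G (g x).
  move=> x1; rewrite /g -[b * _]opprK; apply: is_deriveN.
  exact: is_derive1_powR_onem.
have cts (h : R -> R) x : derivable h x 1 -> {for x, continuous h}.
  by move=> /derivable1_diffP/differentiable_continuous.
have [c0 c1] := (cut_gt0 n, cut_lt_onem n).
have c2 : 1 - cut n < 1 by rewrite gtrBl.
have c3 : 0 < 1 - cut n by exact: lt_trans c1.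
have c4 : cut n < 1 by exact: lt_trans c2.
have bp : (\int[lebesgue_measure]_(x in core n) (F x * g x)%:E =
    (F (1 - cut n) * G (1 - cut n) - F (cut n) * G (cut n))%:E -
    \int[lebesgue_measure]_(x in core n) (f x * G x)%:E)%E.
  apply: integration_by_parts => //.
  - apply: derivable_within_continuous => x; rewrite in_itv/= => /andP[x0 _].
    apply: derivableM => //; apply: ex_derive; apply: is_derive1_powR.
    exact: lt_le_trans x0.
  - split.
    + move=> x; rewrite in_itv/= => /andP[x0 _].
      by apply/ex_derive/dF; exact: lt_trans x0.
    + by apply: cvg_at_right_filter; apply: cts; exact/ex_derive/dF.
    + by apply: cvg_at_left_filter; apply: cts; exact/ex_derive/dF.
  - move=> x; rewrite in_itv/= => /andP[x0 _]; rewrite derive1E.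
    by apply: derive_val; apply: dF; exact: lt_trans x0.
  - apply: derivable_within_continuous => x; rewrite in_itv/= => /andP[_ x1].
    apply: derivableM => //; apply: ex_derive; apply: is_derive1_powR_onem.
    exact: le_lt_trans x1 c2.
  - split.
    + move=> x; rewrite in_itv/= => /andP[_ x1].
      by apply/ex_derive/dG; exact: lt_trans x1 c2.
    + by apply: cvg_at_right_filter; apply: cts; exact/ex_derive/dG.
    + by apply: cvg_at_left_filter; apply: cts; exact/ex_derive/dG.
  - move=> x; rewrite in_itv/= => /andP[_ x1]; rewrite derive1E.
    by apply: derive_val; apply: dG; exact: lt_trans x1 c2.
transitivity (\int[lebesgue_measure]_(x in core n) (F x * g x)%:E)%E.
  apply: eq_integral => x /set_mem/in01 x01.
  by rewrite /beta_density x01 addrK /F /g mulrCA.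
(* The integrand [f * G] is nonpositive on the core, so the minus sign leaves the integral with no
   appeal to integrability. *)
rewrite bp; have -> : (\int[lebesgue_measure]_(x in core n) (f x * G x)%:E =
    - \int[lebesgue_measure]_(x in core n) (a * beta_density a (b + 1) x)%:E)%E.
  rewrite -integral_ge0N; last first.
    by move=> x _; rewrite lee_fin mulr_ge0 ?beta_density_ge0 ?ltW.
  apply: eq_integral => x /set_mem/in01 x01.
  by rewrite -EFinN /beta_density x01 addrK /f /G mulrN mulrA.
rewrite oppeK /F /G; congr (_%:E + _)%E.
by rewrite opprB addrCA subrr addr0; ring.
Qed.

(** Let the cores grow: the boundary terms tend to 0. The identity is kept in the extended reals
    because finiteness of the weights is deduced from it. *)
Lemma beta_weight_by_parts a b : 0 < a -> 0 < b ->
  (b%:E * beta_weight (a + 1) b setT = a%:E * beta_weight a (b + 1) setT)%E.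
Proof.
move=> a0 b0.
have c0 (p q : R) : 0 < p -> cut n `^ p * (1 - cut n) `^ q @[n --> \oo] --> (0 : R).
  move=> p0; have /cvg_at_rightP := cvg_powRM_at_right0 p q p0.
  by move/(_ cut); apply; split.
have cl := @cvgeZl _ _ _ _ _ b%:E isT (cvg_core (a + 1) b).
have cr := @cvgeZl _ _ _ _ _ a%:E isT (cvg_core a (b + 1)).
apply: (cvg_unique (@ereal_hausdorff R) cl).
rewrite (_ : (fun n => _) = (fun n =>
    (cut n `^ a * (1 - cut n) `^ b - cut n `^ b * (1 - cut n) `^ a)%:E +
    a%:E * beta_weight a (b + 1) (core n))%E); last first.
  by apply/funext => n; rewrite core_by_parts.
rewrite -[(a%:E * beta_weight a _ setT)%E]add0e; apply: cvgeD => //.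
apply: cvg_EFin; first exact: nearW.
by rewrite -[X in _ --> X](subrr 0); apply: cvgB; exact: c0.
Qed.

(** Finiteness descends from larger parameters, where the density is bounded. Integration by parts
    makes the weights at [(p + 1, q)] and [(p, q + 1)] finite together, and the weight at [(p, q)]
    is their sum. *)
Lemma beta_weightT_lty a b : 0 < a -> 0 < b -> (beta_weight a b setT < +oo)%E.
Proof.
have mul_lty (k : R) (x : \bar R) : 0 < k -> (k%:E * x < +oo)%E = (x < +oo)%E.
  move=> k0; case: x => [r| |]; first by rewrite -EFinM !ltry.
    by rewrite gt0_muley ?lte_fin// ltxx.
  by rewrite gt0_muleNy ?lte_fin.
have finS (p q : R) : 0 < p -> 0 < q ->
    (beta_weight (p + 1) q setT < +oo)%E = (beta_weight p (q + 1) setT < +oo)%E.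
  move=> p0 q0; rewrite -(mul_lty q _ q0) (beta_weight_by_parts _ _ p0 q0).
  by rewrite (mul_lty p _ p0).
have fin_raise (p q : R) : 0 < p -> 0 < q -> (beta_weight (p + 1) q setT < +oo)%E ->
    (beta_weight p q setT < +oo)%E.
  move=> p0 q0 h; rewrite beta_weightTS; apply: lte_add_pinfty; first exact: h.
  by rewrite -(finS p q p0 q0); exact: h.
move=> a0 b0; have a1 : 0 < a + 1 by rewrite addr_gt0.
(* The chain goes from [(a, b)] to [(a + 1, b)], [(a + 2, b)] and finally [(a + 1, b + 1)]. *)
apply: (fin_raise _ _ a0 b0); apply: (fin_raise _ _ a1 b0).
by rewrite (finS _ _ a1 b0); exact: beta_weightSS_lty.
Qed.

(** Euler's beta function [B(a, b)] for positive parameters. *)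
Definition beta_mass a b : R := fine (beta_weight a b setT).

Lemma beta_massE a b : 0 < a -> 0 < b ->
  beta_weight a b setT = (beta_mass a b)%:E.
Proof.
move=> a0 b0; rewrite /beta_mass fineK// ge0_fin_numE ?measure_ge0//.
exact: beta_weightT_lty.
Qed.

Lemma beta_mass_gt0 a b : 0 < a -> 0 < b -> 0 < beta_mass a b.
Proof.
by move=> a0 b0; rewrite -lte_fin -beta_massE// beta_weight_gt0.
Qed.

(** Solve the linear system [B(a, b) = u + v], [b u = a v] for [u = B(a + 1, b)], with
    [v = B(a, b + 1)]. *)
Lemma beta_massS a b : 0 < a -> 0 < b ->
  beta_mass (a + 1) b = a / (a + b) * beta_mass a b.
Proof.
move=> a0 b0; have [a1 b1] : 0 < a + 1 /\ 0 < b + 1 by rewrite !addr_gt0.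
have := beta_weight_by_parts a b a0 b0; have := beta_weightTS a b.
rewrite (beta_massE _ _ a0 b0) (beta_massE _ _ a1 b0) (beta_massE _ _ a0 b1).
move=> -[->] [].
move: (beta_mass (a + 1) b) (beta_mass a (b + 1)) => u v buav.
have ab0 : a + b != 0 by rewrite gt_eqF// addr_gt0.
apply: (mulfI ab0); rewrite mulrA mulrCA divff// mulr1.
by rewrite mulrDr -buav; ring.
Qed.
End beta_mass.

(** * Moments and tilted means *)

Section tilting.
Context {R : realType}.
Local Open Scope ereal_scope.

(** The total mass of [tilt_weight G k], which is the [k]-th moment when [G] is carried by
    [[0, 1]]. *)
Definition tilt_moment (G : probability R R) (k : nat) : \bar R :=
  \int[G]_x (tilt_density k x)%:E.

Lemma tilt_densityM j k (x : R) :
  (tilt_density j x * tilt_density k x)%R = tilt_density (j + k) x.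
Proof. by rewrite /tilt_density; case: ifP; rewrite ?mulr0// exprD. Qed.

Lemma measurable_tilt_densityE k :
  measurable_fun [set: R] (fun x => (tilt_density k x)%:E).
Proof. by apply/measurable_EFinP; exact: measurable_tilt_density. Qed.

Lemma tilt_densityE_ge0 k (x : R) : 0 <= (tilt_density k x)%:E.
Proof. by rewrite lee_fin tilt_density_ge0. Qed.

Lemma tilt_moment_le1 (G : probability R R) k : tilt_moment G k <= 1.
Proof.
rewrite -(@probability_setT _ _ _ G) -[leRHS]mul1e -integral_cst//.
apply: ge0_le_integral => //.
- by move=> x _; exact: tilt_densityE_ge0.
- exact: measurable_tilt_densityE.
- move=> x _; rewrite lee_fin /tilt_density; case: ifPn => //.
  by rewrite in_itv/= => /andP[x0 x1]; rewrite exprn_ile1.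
Qed.

Lemma tilt_moment_lty (G : probability R R) k : tilt_moment G k < +oo.
Proof. exact: le_lt_trans (tilt_moment_le1 G k) (ltry 1). Qed.

(** Integrating [x] against the density [x^j] produces the next moment; normalization divides by the
    current one. *)
Lemma tilted_meanE (G : probability R R) (j : nat) : 0 < tilt_moment G j ->
  tilted_mean G j = (fine (tilt_moment G j.+1) / fine (tilt_moment G j))%R.
Proof.
move=> m0.
have itilt (g : R -> \bar R) : (forall x, 0 <= g x) -> measurable_fun setT g ->
    \int[tilted G j]_x g x = \int[G]_x (g x * (tilt_density j x)%:E) *
      ((fine (tilt_moment G j))^-1)%:E.
  move=> g0 mg; apply: (@mnormalize_density _ _ _ _ _ G _ _ (@idfun R)) => //.
  - exact: measurable_id.
  - exact: tilt_density_ge0.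
  - exact: measurable_tilt_density.
  - by apply/andP; split; [exact: m0|exact: tilt_moment_lty].
pose out : set R := ~` `[0%R, 1%R].
have mout : measurable out by apply: measurableC; exact: measurable_itv.
have out0 : tilted G j out = 0.
  rewrite -[out]setIT -integral_indic// itilt//; last first.
    by apply/measurable_EFinP; exact: measurable_indic.
  rewrite integral0_eq ?mul0e// => x _.
  rewrite /tilt_density; case: ifPn => [x01|_]; last by rewrite mule0.
  by rewrite indicE memNset ?mul0e//.
rewrite /tilted_mean unlock.
(* [itilt] applies to nonnegative functions only, so the identity is replaced by [tilt_density 1],
   which agrees with it on [[0, 1]], a set of full tilted measure. *)
rewrite (@ae_eq_integral _ _ _ _ _ (fun x => (tilt_density 1 x)%:E))//; last 3 first.
- by apply/measurable_EFinP; exact: measurable_id.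
- exact: measurable_tilt_densityE.
- exists out; split => // x /=.
  apply: contra_not => x01 _.
  by rewrite /tilt_density; move: x01; rewrite /= => ->.
rewrite itilt//; last 2 first.
- exact: tilt_densityE_ge0.
- exact: measurable_tilt_densityE.
under eq_integral do rewrite -EFinM tilt_densityM add1n.
rewrite fineM// ge0_fin_numE//; first exact: tilt_moment_lty.
by apply: integral_ge0 => x _; exact: tilt_densityE_ge0.
Qed.

Lemma beta_dist_integral (a b : R) (g : R -> \bar R) :
  (0 < a)%R -> (0 < b)%R ->
  (forall x, 0 <= g x) -> measurable_fun setT g ->
  \int[beta_dist a b]_x g x =
  \int[lebesgue_measure]_x (g x * (beta_density a b x)%:E) *
  ((beta_mass a b)^-1)%:E.
Proof.
move=> a0 b0 g0 mg; rewrite /beta_mass.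
apply: (@mnormalize_density _ _ (measurableTypeR R) R R lebesgue_measure
  (beta_weight a b) \d_(0%R : R) (@idfun R)) => //.
- exact: measurable_id.
- exact: beta_density_ge0.
- exact: measurable_beta_density.
- by rewrite beta_weight_gt0 beta_weightT_lty.
Qed.

(** The factor [x^k] is absorbed into the density by raising [a] to [a + k]. *)
Lemma beta_dist_moment (a b : R) k : (0 < a)%R -> (0 < b)%R ->
  tilt_moment (beta_dist a b) k = (beta_mass (a + k%:R) b / beta_mass a b)%:E.
Proof.
move=> a0 b0; rewrite /tilt_moment beta_dist_integral//; last 2 first.
- exact: tilt_densityE_ge0.
- exact: measurable_tilt_densityE.
rewrite EFinM -beta_massE//; last by rewrite ltr_wpDr.
congr (_ * _); apply: eq_integral => x _; rewrite -EFinM; congr EFin.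
rewrite /beta_density /tilt_density.
case: (boolP (x \in `]0%R, 1%R[)); rewrite ?mulr0// => /[dup] x01.
rewrite in_itv/= => /andP[x0 x1].
rewrite in_itv/= (ltW x0) (ltW x1) mulrA; congr (_ * _)%R.
rewrite -powR_mulrn ?(ltW x0)// -powRD ?(gt_eqF x0) ?implybT//.
by congr (_ `^ _)%R; ring.
Qed.

Lemma beta_dist_out (a b : R) : (0 < a)%R -> (0 < b)%R ->
  beta_dist a b (~` `[0%R, 1%R]) = 0.
Proof.
move=> a0 b0.
have mout : measurable (~` `[0%R, 1%R] : set R).
  by apply: measurableC; exact: measurable_itv.
rewrite -[X in beta_dist a b X]setIT -integral_indic//.
rewrite beta_dist_integral//; last first.
  by apply/measurable_EFinP; exact: measurable_indic.
rewrite integral0_eq ?mul0e// => x _.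
have [x01|/beta_density01 ->] := boolP (x \in `]0%R, 1%R[); last by rewrite mule0.
rewrite indicE memNset ?mul0e//= ; apply; exact: subset_itv_oo_cc.
Qed.

End tilting.

(** * All-accept probabilities of a general cascade *)

Section cascade.
Context {R : realType} {d : measure_display} {Omega : measurableType d}.
Variables (P : probability Omega R) (C : {RV P >-> bool}).
Variable V : nat -> {RV P >-> bool}.
Local Open Scope ereal_scope.

Lemma measurable_label c : measurable (label C c).
Proof. by rewrite /label -[X in measurable X]setTI; exact: measurable_funPT. Qed.

Lemma measurable_all_accept k : measurable (all_accept V k).
Proof.
rewrite (_ : all_accept V k = \bigcap_(i < k) (V i @^-1` [set true])).
  apply: bigcap_measurableType => i _.
  by rewrite -[X in measurable X]setTI; exact: measurable_funPT.
apply/seteqP; split => [w h i /= ik|w h i]; first exact: (h (Ordinal ik)).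
exact: (h i (ltn_ord i)).
Qed.

(** The first clause of [latent_rate] says that [X] pushes [P] restricted to the label forward to
    [P (label C c)] times [G]; then change variables. *)
Lemma latent_rate_integral c (X : {RV P >-> R}) (G : probability R R)
    (g : R -> \bar R) : latent_rate C V c X G ->
  (forall x, 0 <= g x) -> measurable_fun setT g ->
  \int[P]_(w in label C c) g (X w) = P (label C c) * \int[G]_x g x.
Proof.
move=> [XG _] g0 mg; have mc := measurable_label c.
have mX : measurable_fun setT X by exact: measurable_funPT.
transitivity (\int[mrestr P mc]_w g (X w)).
  rewrite (@ge0_integral_density _ _ _ _ _ P _ idfun \1_(label C c))//; last 3 first.
  - exact: measurable_id.
  - by move=> A mA; rewrite integral_indic// setIC.
  - exact: measurableT_comp.
  by rewrite [LHS]integral_mkcond epatch_indic.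
have := @ge0_integral_pushforward _ _ _ _ R X mX (mrestr P mc) setT g measurableT mg.
rewrite preimage_setT /comp => <-; last by move=> x _.
have pE : P (label C c) = (fine (P (label C c)))%:E.
  by rewrite fineK// fin_num_measure.
have p0 : (0 <= fine (P (label C c)))%R by rewrite fine_ge0.
rewrite (eq_measure_integral (mscale (NngNum p0) G)).
  by rewrite ge0_integral_mscale//= -pE.
move=> A mA _; rewrite [RHS]/= -[RHS]/((fine (P (label C c)))%:E * G A) -pE -XG//.
by rewrite [LHS]/= /pushforward /mrestr setIC.
Qed.

(** The second clause of [latent_rate], with all verdicts true and no constraint on [X], gives the
    integral of [X^k] over the label. *)
Lemma latent_rate_all_accept c (X : {RV P >-> R}) (G : probability R R) k :
  latent_rate C V c X G -> G (~` `[0%R, 1%R]) = 0 ->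
  P (label C c `&` all_accept V k) = P (label C c) * tilt_moment G k.
Proof.
move=> XG Gout; have [GE /(_ k (fun=> true) setT measurableT)] := XG.
have mX : measurable_fun setT X by exact: measurable_funPT.
rewrite preimage_setT setIT => ->.
rewrite -(latent_rate_integral _ _ _ _ XG); last 2 first.
- exact: tilt_densityE_ge0.
- exact: measurable_tilt_densityE.
have mc := measurable_label c.
have mout : measurable (~` `[0%R, 1%R] : set R).
  by apply: measurableC; exact: measurable_itv.
have E (w : Omega) : (\prod_(i < k) bernoulli_pmf (X w) true = X w ^+ k)%R.
  by rewrite /= prodr_const card_ord.
under eq_integral do rewrite E.
apply: ae_eq_integral => //.
- apply: measurable_funTS; apply/measurable_EFinP.
  exact: measurable_funX.
- apply: measurable_funTS; apply/measurable_EFinP.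
  exact: (measurableT_comp (measurable_tilt_density k)).
(* [X^k] and [tilt_density k] of [X] can differ only where [X] leaves [[0, 1]], a null event on the
   label since [G] gives no mass there. *)
- exists (label C c `&` X @^-1` (~` `[0%R, 1%R])); split.
  + apply: measurableI => //; rewrite -[X in measurable X]setTI.
    exact: mX.
  + by rewrite [LHS](GE _ mout) Gout mule0.
  + move=> w /= /not_implyP[cw h]; split => // w01; apply: h.
    by rewrite /tilt_density; move: w01; rewrite /= => ->.
Qed.

End cascade.

(* Kept folded: otherwise [done] tries to unify unequal beta integrals by unfolding
   them down to the Lebesgue measure. *)
Opaque beta_mass.

(** * Moments of the beta laws *)

Section beta_moments.
Context {R : realType}.
Variables a b : R.
Hypotheses (a0 : 0 < a) (b0 : 0 < b).

Definition beta_moment (k : nat) : R := fine (tilt_moment (beta_dist a b) k).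

Lemma beta_momentE k : tilt_moment (beta_dist a b) k = (beta_moment k)%:E.
Proof. by rewrite /beta_moment beta_dist_moment. Qed.

Lemma beta_moment_gt0 k : 0 < beta_moment k.
Proof.
rewrite /beta_moment beta_dist_moment//= divr_gt0// beta_mass_gt0//.
by rewrite ltr_wpDr.
Qed.

(** The normalizing mass cancels, leaving [B(a + k + 1, b) / B(a + k, b)], to which the recursion
    applies. *)
Lemma beta_momentS k :
  beta_moment k.+1 / beta_moment k = (a + k%:R) / (a + b + k%:R).
Proof.
have H (w x y : R) : 0 < x -> 0 < y -> w * y / x / (y / x) = w.
  by move=> x0 y0; rewrite -(mulrA w) mulfK// gt_eqF// divr_gt0.
have ak0 : 0 < a + k%:R by rewrite ltr_wpDr.
have Ba := beta_mass_gt0 _ _ a0 b0; have Bk := beta_mass_gt0 _ _ ak0 b0.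
have abk0 : 0 < a + b + k%:R by rewrite addrAC addr_gt0.
rewrite /beta_moment !beta_dist_moment// /fine.
have -> : a + k.+1%:R = a + k%:R + 1 by rewrite -natr1 addrA.
rewrite (beta_massS _ _ ak0 b0) [a + k%:R + b]addrAC.
exact: H.
Qed.

Lemma tilted_mean_beta k :
  tilted_mean (beta_dist a b) k = (a + k%:R) / (a + b + k%:R).
Proof.
rewrite tilted_meanE -?beta_momentS// beta_momentE lte_fin.
exact: beta_moment_gt0.
Qed.

End beta_moments.

Opaque beta_moment.

Lemma odds_ratio (F : fieldType) (p q x x' y y' : F) :
  p != 0 -> q != 0 -> x != 0 -> y != 0 -> y' != 0 ->
  p * x' / (q * y') / (p * x / (q * y)) = x' / x / (y' / y).
Proof. by move=> p0 q0 x0 y0 y'0; field; rewrite p0 q0 x0 y0 y'0. Qed.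

(** * Posterior odds under beta rates *)

Section posterior.
Context {R : realType} {d : measure_display} {Omega : measurableType d}.
Variables (P : probability Omega R) (C : {RV P >-> bool}).
Variables (alpha beta : {RV P >-> R}) (V : nat -> {RV P >-> bool}).
Variables p0 aa ba ab bb : R.
Hypotheses (p00 : 0 < p0) (p01 : p0 < 1).
Hypotheses (aa0 : 0 < aa) (ba0 : 0 < ba) (ab0 : 0 < ab) (bb0 : 0 < bb).
Hypothesis cascadeP :
  two_sided_cascade C alpha beta V p0 (beta_dist aa ba) (beta_dist ab bb).

Lemma probability_label_false : P (label C false) = (1 - p0)%:E.
Proof.
have -> : label C false = ~` label C true.
  by apply/seteqP; split => w; rewrite /label /=; case: (C w).
rewrite probability_setC; last exact: measurable_label.
by rewrite (cascade_prior cascadeP).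
Qed.

(** Bayes' rule, with the all-accept event split according to the label. *)
Lemma posteriorE k : posterior C V k = p0 * beta_moment ab bb k /
  (p0 * beta_moment ab bb k + (1 - p0) * beta_moment aa ba k).
Proof.
have PT : P (label C true `&` all_accept V k) = (p0 * beta_moment ab bb k)%:E.
  rewrite (latent_rate_all_accept _ _ _ _ _ _ _ (cascade_true_accept cascadeP)).
    by rewrite (cascade_prior cascadeP) beta_momentE// -EFinM.
  exact: beta_dist_out.
have PF : P (label C false `&` all_accept V k) =
    ((1 - p0) * beta_moment aa ba k)%:E.
  rewrite (latent_rate_all_accept _ _ _ _ _ _ _ (cascade_false_accept cascadeP)).
    rewrite (beta_momentE _ _ aa0 ba0) [P (label C false)]probability_label_false.
    by rewrite [RHS]EFinM; reflexivity.
  exact: beta_dist_out.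
have PA : P (all_accept V k) =
    (p0 * beta_moment ab bb k + (1 - p0) * beta_moment aa ba k)%:E.
  have -> : all_accept V k = (label C true `&` all_accept V k) `|`
      (label C false `&` all_accept V k).
    rewrite -setIUl; apply/esym/setIidr => w _.
    by rewrite /label /=; case: (C w); [left|right].
  transitivity (P (label C true `&` all_accept V k) +
      P (label C false `&` all_accept V k))%E; last by rewrite PT PF.
  apply: measureU.
  - apply: measurableI; [exact: measurable_label|exact: measurable_all_accept].
  - apply: measurableI; [exact: measurable_label|exact: measurable_all_accept].
  - by apply/seteqP; split => // w [[+ _] [+ _]]; rewrite /label /= => ->.
by rewrite /posterior PT PA.
Qed.

Let num_gt0 k : 0 < p0 * beta_moment ab bb k.
Proof. by rewrite mulr_gt0// beta_moment_gt0. Qed.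

Let den_gt0 k : 0 < (1 - p0) * beta_moment aa ba k.
Proof. by rewrite mulr_gt0 ?subr_gt0// beta_moment_gt0. Qed.

Lemma posterior_gt0 k : 0 < posterior C V k.
Proof. by rewrite posteriorE divr_gt0// addr_gt0. Qed.

Lemma posterior_lt1 k : posterior C V k < 1.
Proof. by rewrite posteriorE ltr_pdivrMr ?addr_gt0// mul1r ltrDl. Qed.

Lemma log_oddsE k : log_odds C V k =
  ln (p0 * beta_moment ab bb k / ((1 - p0) * beta_moment aa ba k)).
Proof.
rewrite /log_odds posteriorE; congr ln.
have := num_gt0 k; have := den_gt0 k.
move: (p0 * _) ((1 - p0) * _) => x y y0 x0.
have xy0 : x + y != 0 by rewrite gt_eqF// addr_gt0.
have -> : 1 - x / (x + y) = y / (x + y) by field.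
by rewrite invf_div mulrA divfK.
Qed.

(** The logit is strictly increasing on []0, 1[]; this transfers the sign of the evidence to the
    monotonicity of the posterior. *)
Lemma log_odds_lt k l :
  (log_odds C V k < log_odds C V l) = (posterior C V k < posterior C V l).
Proof.
have r1 n : 0 < 1 - posterior C V n by rewrite subr_gt0 posterior_lt1.
have o0 n : 0 < posterior C V n / (1 - posterior C V n).
  by apply: divr_gt0; [exact: posterior_gt0|exact: r1].
rewrite /log_odds ltr_ln ?posrE//.
rewrite ltr_pdivrMr// mulrAC ltr_pdivlMr//.
by rewrite !mulrBr !mulr1 mulrC ltrD2r.
Qed.

(** The prior odds cancel between consecutive gates, and the ratio of consecutive moments is the
    tilted mean. *)
Lemma net_evidenceE j : net_evidence C V j.+1 =
  ln (tilted_mean (beta_dist ab bb) j / tilted_mean (beta_dist aa ba) j).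
Proof.
rewrite /net_evidence !log_oddsE -ln_div ?posrE ?divr_gt0//.
rewrite (tilted_mean_beta _ _ aa0 ba0) (tilted_mean_beta _ _ ab0 bb0).
rewrite -(beta_momentS _ _ aa0 ba0) -(beta_momentS _ _ ab0 bb0); congr ln.
have pos_neq0 (x : R) : 0 < x -> x != 0 by move=> x0; rewrite gt_eqF.
apply: odds_ratio; apply: pos_neq0; first exact: p00.
- by rewrite subr_gt0.
- exact: beta_moment_gt0.
- exact: beta_moment_gt0.
- exact: beta_moment_gt0.
Qed.

End posterior.

(** * Evidence, its sign changes and the optimal number of gates *)

Theorem proposition4p3 (R : realType) (p0 a_alpha b_alpha a_beta b_beta : R)
    (d : measure_display) (Omega : measurableType d) (P : probability Omega R)
    (C : {RV P >-> bool}) (alpha beta : {RV P >-> R})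
    (V : nat -> {RV P >-> bool}) :
  0 < p0 -> p0 < 1 ->
  0 < a_alpha -> 0 < b_alpha -> 0 < a_beta -> 0 < b_beta ->
  let G := beta_dist a_alpha b_alpha in
  let H := beta_dist a_beta b_beta in
  two_sided_cascade C alpha beta V p0 G H ->
  let r := posterior C V in
  let delta := net_evidence C V in
  let formula := evidence_formula a_alpha b_alpha a_beta b_beta in
  let kdag := k_dagger a_alpha b_alpha a_beta b_beta in
  let nonneg := [set x : R | 0 <= x] in
  (forall j : nat,
     [/\ delta j.+1 = ln (tilted_mean H j / tilted_mean G j),
         delta j.+1 = formula j%:R
       & 0 < delta j.+1 <-> tilted_mean G j < tilted_mean H j]) /\
  (sign_changes_at_most_once [set: nat] (fun j => delta j.+1) /\
   sign_changes_at_most_once nonneg formula) /\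
  (b_alpha != b_beta ->
     (forall t : R, 0 <= t -> sign_change_at nonneg formula t -> t = kdag) /\
     (forall x y : R, 0 <= x -> x < y -> formula x * formula y < 0 ->
        x < kdag < y)) /\
  (b_alpha < b_beta -> 0 < delta 1%N ->
     exists k_opt : nat,
       [/\ k_opt%:Z = Num.ceil kdag,
           forall k : nat, (k < k_opt)%N -> r k < r k.+1,
           forall k : nat, (k_opt <= k)%N ->
             r k.+1 <= r k /\ (k%:R != kdag -> r k.+1 < r k)
         & forall k : nat, r k <= r k_opt]).
Proof.
move=> p00 p01 aa0 ba0 ab0 bb0 G H cas r delta formula kdag nonneg.
have deltaE j : delta j.+1 = ln (tilted_mean H j / tilted_mean G j).
  exact: (net_evidenceE _ _ _ _ _ _ _ _ _ _ p00 p01 aa0 ba0 ab0 bb0 cas).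
have deltaF j : delta j.+1 = formula j%:R.
  rewrite deltaE (tilted_mean_beta _ _ aa0 ba0) (tilted_mean_beta _ _ ab0 bb0).
  reflexivity.
have mean_gt0 (a b : R) j : 0 < a -> 0 < b -> 0 < tilted_mean (beta_dist a b) j.
  by move=> a0 b0; rewrite tilted_mean_beta// divr_gt0// ltr_wpDr// addr_gt0.
have r_lt j l : (log_odds C V j < log_odds C V l) = (r j < r l).
  exact: (log_odds_lt _ _ _ _ _ _ _ _ _ _ p00 p01 aa0 ba0 ab0 bb0 cas).
have dE j : delta j.+1 = log_odds C V j.+1 - log_odds C V j by [].
have r_up j : (0 < formula j%:R) = (r j < r j.+1).
  rewrite -deltaF dE subr_gt0 r_lt; reflexivity.
have r_down j : (formula j%:R < 0) = (r j.+1 < r j).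
  rewrite -deltaF dE subr_lt0 r_lt; reflexivity.
split; [|split; [split|split]].
- move=> j; split => //; rewrite deltaE.
  have [mG mH] : 0 < tilted_mean G j /\ 0 < tilted_mean H j.
    by split; exact: mean_gt0.
  rewrite (ln_div_gt0 _ _ mH mG); exact: iff_refl.
(* The integer statement is the real one restricted along the order embedding of the naturals. *)
- move=> x y z _ _ _ xy yz; rewrite !deltaF.
  apply: evidence_formula_sign_changes => //=; rewrite ?ler0n// ltr_nat.
  + exact: xy.
  + exact: yz.
- exact: evidence_formula_sign_changes.
- move=> bab; split => [t t0|x y x0 xy].
  + exact: evidence_formula_sign_change_at.
  + exact: evidence_formulaM_lt0_between.
- move=> bab delta1.
  have bab' : b_alpha != b_beta by rewrite lt_eqF.
  have bab0 : b_alpha - b_beta < 0 by rewrite subr_lt0.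
  (* The slope [b_alpha - b_beta] is negative, so the evidence is positive before [kdag] and
     negative after it. *)
  have f_gt0 j : (0 < formula j%:R) = (j%:R < kdag).
    rewrite evidence_formula_gt0// evidence_numeratorE//.
    by rewrite nmulr_rgt0// subr_lt0.
  have f_lt0 j : (formula j%:R < 0) = (kdag < j%:R).
    rewrite evidence_formula_lt0// evidence_numeratorE//.
    by rewrite nmulr_rlt0// subr_gt0.
  (* The first gate is [j = 0], so its positive evidence places 0 before [kdag]. The ceiling is then
     nonnegative and equals its absolute value. *)
  have kdag0 : 0 < kdag by move: delta1; rewrite deltaF f_gt0.
  have ceil_kdag_ge0 : 0 <= Num.ceil kdag.
    by rewrite ceil_ge0// (lt_trans _ kdag0)// ltrN10.
  pose k_opt := `|Num.ceil kdag|%N.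
  have kE : k_opt%:Z = Num.ceil kdag by rewrite /k_opt gez0_abs.
  have lt_opt j : (j < k_opt)%N = (j%:R < kdag).
    by rewrite -ltz_nat kE ceil_gt_int.
  have up k : (k < k_opt)%N -> r k < r k.+1.
    by rewrite lt_opt -r_up f_gt0.
  have down k : (k_opt <= k)%N -> r k.+1 <= r k.
    by rewrite leqNgt lt_opt -f_gt0 r_up -leNgt.
  exists k_opt; split => //.
  (* From [k_opt] on, [kdag <= k]; a tie requires equality, which is why strict decrease is claimed
     away from [kdag]. *)
  + move=> k kk; split; first exact: down.
    move=> kneq; rewrite -r_down f_lt0 lt_neqAle eq_sym kneq/=.
    by rewrite leNgt -lt_opt -leqNgt.
  (* Induction on the distance to [k_opt]: descending steps link [k_opt] to a later [k], ascending
     steps link an earlier [k] to it. *)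
  + move=> k; have [kk|/ltnW kk] := leqP k_opt k.
    * rewrite -(subnKC kk); elim: (k - k_opt)%N => [|n IH]; first by rewrite addn0.
      by rewrite addnS (le_trans _ IH)// down// leq_addr.
    * rewrite -(subKn kk); elim: (k_opt - k)%N (leq_subr k k_opt) => [|n IH].
        by rewrite subn0.
      move=> nk; apply: le_trans (IH (ltnW nk)).
      have := up (k_opt - n.+1)%N; rewrite subnSK// => h; apply/ltW/h.
      exact: leq_subr.
Qed.
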